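(* There is an algorithm which, given a finite set $S\subseteq\mathrm{GL}(n,\mathbb{Q})$ and a common denominator $d$ for the group $H=\langle S\rangle$, terminates and returns an element $g\in\mathrm{GL}(n,\mathbb{Q})$ such that $g^{-1}Hg\leq\mathrm{GL}(n,\mathbb{Z})$, together with a finite generating set of $H_{\mathbb{Z}}$.
   Context: For $H\leq\mathrm{GL}(n,\mathbb{Q})$, $H_{\mathbb{Z}}=H\cap\mathrm{GL}(n,\mathbb{Z})$. A common denominator for $H$ is a positive integer $d$ such that $dh\in\mathrm{Mat}(n,\mathbb{Z})$ for all $h\in H$. *)

(* Defs.v *)
From HB Require Import structures.
From mathcomp Require Import all_boot all_order all_algebra.

Set Implicit Arguments.
Unset Strict Implicit.
Unset Printing Implicit Defensive.

Import Order.TTheory GRing.Theory Num.Theory.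
Local Open Scope ring_scope.

(* An algorithm is a program of a Turing-complete language computing on
   finite binary trees: a point-free form of the one-variable WHILE language
   of N. D. Jones, "Computability and Complexity from a Programming
   Perspective". As in Lisp, [Leaf] plays the role of nil and of false, every
   other tree is true, and the head and tail of [Leaf] are [Leaf]. *)

Inductive tree : Type := Leaf | Node of tree & tree.

Definition hd (t : tree) : tree := if t is Node a _ then a else Leaf.
Definition tl (t : tree) : tree := if t is Node _ b then b else Leaf.

Inductive prog : Type :=
| Id
| Nil
| Hd
| Tl
| Cons of prog & prog
| Seq of prog & prog
| If of prog & prog & prog
| While of prog & prog.

(* [exec p x y]: started on the input x, the program p halts with output y.
   [Seq p q] runs p first; [While c p] replaces x by the output of p on x as
   long as c outputs true on x. *)
Inductive exec : prog -> tree -> tree -> Prop :=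
| exec_id x : exec Id x x
| exec_nil x : exec Nil x Leaf
| exec_hd x : exec Hd x (hd x)
| exec_tl x : exec Tl x (tl x)
| exec_cons p q x y z :
    exec p x y -> exec q x z -> exec (Cons p q) x (Node y z)
| exec_seq p q x y z :
    exec p x y -> exec q y z -> exec (Seq p q) x z
| exec_if_true c p q x a b y :
    exec c x (Node a b) -> exec p x y -> exec (If c p q) x y
| exec_if_false c p q x y :
    exec c x Leaf -> exec q x y -> exec (If c p q) x y
| exec_while_true c p x a b y z :
    exec c x (Node a b) -> exec p x y -> exec (While c p) y z ->
    exec (While c p) x z
| exec_while_false c p x :
    exec c x Leaf -> exec (While c p) x x.

(* Execution is deterministic, so the existence of a halting execution does
   mean that the program terminates, with a unique output. *)
Lemma exec_det (p : prog) (x y z : tree) : exec p x y -> exec p x z -> y = z.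
Proof.
move=> pxy; elim: pxy z => {p x y};
  intros; match goal with H : exec _ _ ?w |- _ = ?w => inversion H; subst end;
  repeat match goal with
  | IH : forall w, exec ?p ?x w -> _ = w, H : exec ?p ?x ?v |- _ =>
      move: (IH _ H) => ?; clear H; subst
  end; by [].
Qed.

(* Encodings of the data as trees: a number n is the list of n leaves, an
   integer is a sign and an absolute value, a rational is its reduced
   fraction, a matrix is the list of its rows. *)

Definition enc_seq (T : Type) (enc : T -> tree) (s : seq T) : tree :=
  foldr (fun x t => Node (enc x) t) Leaf s.

Definition enc_nat (n : nat) : tree := iter n (Node Leaf) Leaf.

Definition enc_bool (b : bool) : tree := if b then Node Leaf Leaf else Leaf.

Definition enc_int (z : int) : tree :=
  Node (enc_bool (z < 0)) (enc_nat `|z|%N).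

Definition enc_rat (q : rat) : tree :=
  Node (enc_int (numq q)) (enc_int (denq q)).

Definition enc_mx (n : nat) (A : 'M[rat]_n) : tree :=
  enc_seq (fun i => enc_seq (fun j => enc_rat (A i j)) (enum 'I_n))
          (enum 'I_n).

(* The size n is part of the input: one program handles all dimensions. *)
Definition enc_input (n : nat) (S : seq 'M[rat]_n) (d : nat) : tree :=
  Node (enc_nat n) (Node (enc_seq (@enc_mx n) S) (enc_nat d)).

Definition enc_output (n : nat) (g : 'M[rat]_n) (T : seq 'M[rat]_n) : tree :=
  Node (enc_mx g) (enc_seq (@enc_mx n) T).

(* The library's ['GL_n[R]] requires R finite, so subgroups of GL(n, Q) are
   predicates on ['M[rat]_n]. The subgroup <S> below is meant for S contained
   in [unitmx]. *)
Inductive gen_group (n : nat) (S : seq 'M[rat]_n) : 'M[rat]_n -> Prop :=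
| gen_group_mem A : A \in S -> gen_group S A
| gen_group_1 : gen_group S 1%:M
| gen_group_mul A B : gen_group S A -> gen_group S B -> gen_group S (A *m B)
| gen_group_inv A : gen_group S A -> gen_group S (invmx A).

Definition is_int_mx (n : nat) (A : 'M[rat]_n) : Prop :=
  exists B : 'M[int]_n, A = map_mx intr B.

(* [B \in unitmx] is invertibility over int. *)
Definition in_GLZ (n : nat) (A : 'M[rat]_n) : Prop :=
  exists2 B : 'M[int]_n, B \in unitmx & A = map_mx intr B.

Definition int_part (n : nat) (H : 'M[rat]_n -> Prop) (A : 'M[rat]_n) : Prop :=
  H A /\ in_GLZ A.

Definition common_denominator (n : nat) (H : 'M[rat]_n -> Prop) (d : nat) :
  Prop := (0 < d)%N /\ forall A, H A -> is_int_mx (d%:R *: A).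

(* Main.v *)
Require Import Defs.
From mathcomp Require Import all_boot all_order all_algebra.
From Stdlib Require Import Classical.
From mathcomp Require Import zify ring.

Set Implicit Arguments.
Unset Strict Implicit.
Unset Printing Implicit Defensive.

Import Order.TTheory GRing.Theory Num.Theory.

(* Left multiplication by H permutes the left cosets of H_Z, and there are
   finitely many of them: if d h and d h' are congruent modulo d^2, then
   h^-1 h' is integral. Hence for large k every product of k+1 generators (and
   inverses) is v t with v a product of at most k of them and t in H_Z, and
   the elements of H_Z of length at most 2k+1 generate H_Z, as in Schreier's
   lemma. For the conjugator, take an integral g with h g integral for all h in
   H, nonsingular and of minimal |det g|. Both facts, once they hold for some k
   and g, are checked on finitely many matrices, so the program searches through
   all k and all matrices of bounded height; the denominator d only serves to
   guarantee that the search ends. *)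

(** * Tree encodings and the functions that programs compute on them *)

Class Enc (X : Type) := encode : X -> tree.

#[global] Instance Enc_unit : Enc unit := fun=> Leaf.
#[global] Instance Enc_bool : Enc bool := enc_bool.
#[global] Instance Enc_nat : Enc nat := enc_nat.
#[global] Instance Enc_int : Enc int := enc_int.
#[global] Instance Enc_rat : Enc rat := enc_rat.
#[global] Instance Enc_pair X Y {eX : Enc X} {eY : Enc Y} : Enc (X * Y) :=
  fun z => Node (encode z.1) (encode z.2).
#[global] Instance Enc_seq X {eX : Enc X} : Enc (seq X) :=
  enc_seq (@encode X eX).

(** Covers total functions, with one program for all inputs; unbounded search is treated apart, in
    [exec_search]. *)
Definition comp (X Y : Type) {eX : Enc X} {eY : Enc Y} (f : X -> Y) : Prop :=
  exists p, forall x, exec p (encode x) (encode (f x)).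

(* The closure lemmas below are stated for functions of a context [x : X];
   a bound variable is added to the context as a pair. *)
Create HintDb comp.
Ltac comp := typeclasses eauto with comp typeclass_instances.

(** * Computable functions *)

Section Closure.
Context {X Y Z : Type} {eX : Enc X} {eY : Enc Y} {eZ : Enc Z}.

Lemma comp_ext (f g : X -> Y) : f =1 g -> comp f -> comp g.
Proof. by move=> fg [p pP]; exists p => x; rewrite -fg. Qed.

Lemma comp_id : comp (fun x : X => x).
Proof. by exists Id => x; apply: exec_id. Qed.

Lemma comp_const (y : Y) : comp (fun _ : X => y).
Proof.
suff quote t : exists p, forall x, exec p x t.
  by have [p pP] := quote (encode y); exists p.
elim: t => [|a [p pP] b [q qP]]; first by exists Defs.Nil => x; apply: exec_nil.
by exists (Defs.Cons p q) => x; apply: exec_cons.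
Qed.

Lemma comp_app (f : X -> Y) (g : Y -> Z) :
  comp g -> comp f -> comp (fun x => g (f x)).
Proof.
move=> [q qP] [p pP]; exists (Seq p q) => x.
exact: exec_seq (pP x) (qP _).
Qed.

Lemma comp_pair (f : X -> Y) (g : X -> Z) :
  comp f -> comp g -> comp (fun x => (f x, g x)).
Proof. by move=> [p pP] [q qP]; exists (Defs.Cons p q) => x; apply: exec_cons. Qed.

Lemma comp_fst (f : X -> Y * Z) : comp f -> comp (fun x => (f x).1).
Proof.
case=> p pP; exists (Seq p Hd) => x.
exact: exec_seq (pP x) (exec_hd _).
Qed.

Lemma comp_snd (f : X -> Y * Z) : comp f -> comp (fun x => (f x).2).
Proof.
move=> [p pP]; exists (Seq p Tl) => x.
exact: exec_seq (pP x) (exec_tl _).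
Qed.

Lemma comp_if (b : X -> bool) (f g : X -> Y) :
  comp b -> comp f -> comp g -> comp (fun x => if b x then f x else g x).
Proof.
move=> [c cP] [p pP] [q qP]; exists (If c p q) => x.
move: (cP x); case: (b x) => cx; last exact: exec_if_false cx (qP x).
exact: exec_if_true cx (pP x).
Qed.

Lemma comp_cons (f : X -> Y) (s : X -> seq Y) :
  comp f -> comp s -> comp (fun x => f x :: s x).
Proof. by move=> [p pP] [q qP]; exists (Defs.Cons p q) => x; apply: exec_cons. Qed.

(** The loop to which the other bounded recursions reduce. Its state is [(x, (l, b))], with [l]
    still to be read and [b] the accumulator; the encoded [l] itself is the loop test, since the
    empty list is [Leaf]. *)
Lemma comp_foldl (F : X -> Z -> Y -> Z) (a : X -> Z) (s : X -> seq Y) :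
  comp (fun z : X * (Y * Z) => F z.1 z.2.2 z.2.1) -> comp a -> comp s ->
  comp (fun x => foldl (F x) (a x) (s x)).
Proof.
move=> [pF FP] [pa aP] [ps sP].
(* One round turns [(x, (y :: l, b))] into [(x, (l, F x b y))]; the argument prepared for [pF] is
   [(x, (y, b))]. *)
pose body := Defs.Cons Hd (Defs.Cons (Seq Tl (Seq Hd Tl))
  (Seq (Defs.Cons Hd (Defs.Cons (Seq Tl (Seq Hd Hd)) (Seq Tl Tl))) pF)).
exists (Seq (Seq (Defs.Cons Id (Defs.Cons ps pa)) (While (Seq Tl Hd) body)) (Seq Tl Tl)).
have loop x l b : exec (While (Seq Tl Hd) body) (encode (x, (l, b)))
    (encode (x, ([::] : seq Y, foldl (F x) b l))).
  elim: l b => [|y l IH] b.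
    apply: exec_while_false.
    exact: exec_seq (exec_tl _) (exec_hd _).
  apply: exec_while_true (IH _).
    exact: exec_seq (exec_tl _) (exec_hd _).
  apply: exec_cons; first exact: exec_hd.
  apply: exec_cons.
    exact: exec_seq (exec_tl _) (exec_seq (exec_hd _) (exec_tl _)).
  apply: exec_seq (FP (x, (y, b))).
  apply: exec_cons; first exact: exec_hd.
  apply: exec_cons; last exact: exec_seq (exec_tl _) (exec_tl _).
  exact: exec_seq (exec_tl _) (exec_seq (exec_hd _) (exec_hd _)).
move=> x; apply: exec_seq.
  apply: exec_seq (loop x (s x) (a x)).
  apply: exec_cons; first exact: exec_id.
  exact: exec_cons.
exact: exec_seq (exec_tl _) (exec_tl _).
Qed.

End Closure.

Lemma comp_fst0 {Y Z : Type} {eY : Enc Y} {eZ : Enc Z} : comp (@fst Y Z).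
Proof. exact/comp_fst/comp_id. Qed.

Lemma comp_snd0 {Y Z : Type} {eY : Enc Y} {eZ : Enc Z} : comp (@snd Y Z).
Proof. exact/comp_snd/comp_id. Qed.

#[global] Hint Constants Opaque : comp.
#[global] Hint Resolve comp_id comp_const comp_pair comp_fst comp_snd
  comp_fst0 comp_snd0
  comp_cons comp_foldl : comp.
#[global] Hint Extern 1 (comp _) => lazymatch goal with
  | |- context [if _ then _ else _] => refine (comp_if _ _ _)
  end : comp.
#[global] Hint Extern 1 (comp _) => match goal with
  | H : comp ?f |- comp (fun x => ?f (@?a x)) => refine (comp_app H _)
  | H : comp (fun z => ?F z.1 z.2) |- comp (fun x => ?F (@?a x) (@?b x)) =>
      refine (comp_app H (f := fun x => (a x, b x)) _)
  end : comp.
#[global] Hint Extern 0 (comp _) => progress cbv beta : comp.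

Lemma comp_rev {X Y : Type} {eX : Enc X} {eY : Enc Y}
    (s : X -> seq Y) : comp s -> comp (fun x => rev (s x)).
Proof.
move=> cs; apply: (@comp_ext _ _ _ _
  (fun x => foldl (fun l y => y :: l) [::] (s x))); last by comp.
by move=> x; rewrite /rev; elim: (s x) [::] => //= y l IH b; rewrite IH.
Qed.
#[global] Hint Resolve comp_rev : comp.

Lemma comp_foldr {X Y Z : Type} {eX : Enc X} {eY : Enc Y} {eZ : Enc Z}
    (F : X -> Y -> Z -> Z) (a : X -> Z) (s : X -> seq Y) :
  comp (fun z : X * (Y * Z) => F z.1 z.2.1 z.2.2) -> comp a -> comp s ->
  comp (fun x => foldr (F x) (a x) (s x)).
Proof.
move=> cF ca cs; apply: (@comp_ext _ _ _ _
  (fun x => foldl (fun b y => F x y b) (a x) (rev (s x)))); last by comp.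
by move=> x; rewrite foldl_rev.
Qed.
#[global] Hint Resolve comp_foldr : comp.

Lemma comp_map {X Y Z : Type} {eX : Enc X} {eY : Enc Y} {eZ : Enc Z}
    (F : X -> Y -> Z) (s : X -> seq Y) :
  comp (fun z : X * Y => F z.1 z.2) -> comp s ->
  comp (fun x => map (F x) (s x)).
Proof.
move=> cF cs; apply: (@comp_ext _ _ _ _
  (fun x => foldr (fun y l => F x y :: l) [::] (s x))) => [x|].
  by elim: (s x) => //= y l ->.
by comp.
Qed.

Section Bool.
Context {X : Type} {eX : Enc X}.

Lemma comp_andb (f g : X -> bool) : comp f -> comp g -> comp (fun x => f x && g x).
Proof. by move=> cf cg; apply: comp_if cf cg _; comp. Qed.

Lemma comp_orb (f g : X -> bool) : comp f -> comp g -> comp (fun x => f x || g x).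
Proof. by move=> cf cg; apply: comp_if cf _ cg; comp. Qed.

Lemma comp_negb (f : X -> bool) : comp f -> comp (fun x => ~~ f x).
Proof. by move=> cf; apply: (comp_if (f := fun=> false)) cf _ _; comp. Qed.

End Bool.
#[global] Hint Resolve comp_andb comp_orb comp_negb : comp.

Lemma comp_eqb {X : Type} {eX : Enc X} (f g : X -> bool) :
  comp f -> comp g -> comp (fun x => f x == g x).
Proof.
move=> cf cg; apply: (@comp_ext _ _ _ _ (fun x => if f x then g x else ~~ g x)).
  by move=> x; case: (f x); case: (g x).
by comp.
Qed.
#[global] Hint Resolve comp_eqb : comp.

Section Seq.
Context {X Y : Type} {eX : Enc X} {eY : Enc Y}.
Implicit Types (P : X -> Y -> bool) (s t : X -> seq Y).

Lemma comp_cat s t : comp s -> comp t -> comp (fun x => s x ++ t x).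
Proof.
move=> cs ct; apply: (@comp_ext _ _ _ _ (fun x => foldr cons (t x) (s x))).
  by move=> x; elim: (s x) => //= y l ->.
by apply: comp_foldr; comp.
Qed.

Lemma comp_all P s : comp (fun z : X * Y => P z.1 z.2) -> comp s ->
  comp (fun x => all (P x) (s x)).
Proof.
move=> cP cs; apply: (@comp_ext _ _ _ _
  (fun x => foldr (fun y b => P x y && b) true (s x))) => [x|].
  by elim: (s x) => //= y l ->.
by comp.
Qed.

Lemma comp_has P s : comp (fun z : X * Y => P z.1 z.2) -> comp s ->
  comp (fun x => has (P x) (s x)).
Proof.
move=> cP cs; apply: (@comp_ext _ _ _ _
  (fun x => foldr (fun y b => P x y || b) false (s x))) => [x|].
  by elim: (s x) => //= y l ->.
by comp.
Qed.

Lemma comp_filter P s : comp (fun z : X * Y => P z.1 z.2) -> comp s ->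
  comp (fun x => filter (P x) (s x)).
Proof.
move=> cP cs; apply: (@comp_ext _ _ _ _
  (fun x => foldr (fun y l => if P x y then y :: l else l) [::] (s x))) => [x|].
  by elim: (s x) => //= y l ->.
by comp.
Qed.

Lemma comp_head (y : X -> Y) s : comp y -> comp s -> comp (fun x => head (y x) (s x)).
Proof.
move=> cy cs; apply: (@comp_ext _ _ _ _
  (fun x => foldr (fun z _ => z) (y x) (s x))) => [x|]; last by comp.
by case: (s x).
Qed.

Lemma comp_behead s : comp s -> comp (fun x => behead (s x)).
Proof.
move=> [p pP]; exists (Seq p Tl) => x.
by apply: exec_seq (pP x) _; case: (s x) => [|y l]; apply: exec_tl.
Qed.

End Seq.
#[global] Hint Resolve comp_map comp_cat comp_all comp_has comp_filter comp_head
  comp_behead : comp.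

Lemma comp_flatten {X Y : Type} {eX : Enc X} {eY : Enc Y} (s : X -> seq (seq Y)) :
  comp s -> comp (fun x => flatten (s x)).
Proof. by move=> cs; apply: comp_foldr; comp. Qed.
#[global] Hint Resolve comp_flatten : comp.

Lemma comp_allpairs {X Y Z T : Type}
    {eX : Enc X} {eY : Enc Y} {eZ : Enc Z} {eT : Enc T}
    (F : X -> Y -> Z -> T) (s : X -> seq Y) (t : X -> Y -> seq Z) :
  comp (fun z : X * Y * Z => F z.1.1 z.1.2 z.2) -> comp s ->
  comp (fun z : X * Y => t z.1 z.2) ->
  comp (fun x => [seq F x y z | y <- s x, z <- t x y]).
Proof. by move=> cF cs ct; apply: comp_flatten; apply: comp_map cs; apply: (comp_map cF). Qed.
#[global] Hint Resolve comp_allpairs : comp.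

(** A unary number is literally a list of units, so iteration becomes a fold over that list. *)
Lemma encode_nseq (n : nat) : encode (nseq n tt) = encode n.
Proof. by rewrite /encode /Enc_nat /enc_nat; elim: n => //= n <-. Qed.

Section Nat.
Context {X : Type} {eX : Enc X}.
Implicit Types m n : X -> nat.

Lemma comp_succn n : comp n -> comp (fun x => (n x).+1).
Proof.
by move=> [p pP]; exists (Defs.Cons Defs.Nil p) => x; apply: exec_cons => //; apply: exec_nil.
Qed.

Lemma comp_predn n : comp n -> comp (fun x => (n x).-1).
Proof.
move=> [p pP]; exists (Seq p Tl) => x.
by apply: exec_seq (pP x) _; case: (n x) => [|k]; apply: exec_tl.
Qed.

Lemma comp_eqn0 n : comp n -> comp (fun x => n x == 0%N).
Proof.
move=> [p pP]; exists (If p Defs.Nil (Defs.Cons Defs.Nil Defs.Nil)) => x.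
move: (pP x); case: (n x) => [|k] e.
  by apply: exec_if_false e _; apply: exec_cons; apply: exec_nil.
by apply: exec_if_true e _; apply: exec_nil.
Qed.

Lemma comp_iter {Y : Type} {eY : Enc Y} n (F : X -> Y -> Y) (a : X -> Y) :
  comp (fun z : X * Y => F z.1 z.2) -> comp n -> comp a ->
  comp (fun x => iter (n x) (F x) (a x)).
Proof.
move=> cF [p pP] ca.
have cn : comp (fun x => nseq (n x) tt).
  exists p => x; by rewrite encode_nseq.
apply: (@comp_ext _ _ _ _ (fun x => foldr (fun=> F x) (a x) (nseq (n x) tt))).
  by move=> x; elim: (n x) => //= k ->.
by comp.
Qed.

End Nat.
#[global] Hint Resolve comp_succn comp_predn comp_eqn0 comp_iter : comp.

Lemma comp_addn {X : Type} {eX : Enc X} (m n : X -> nat) : comp m -> comp n -> comp (fun x => m x + n x)%N.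
Proof.
move=> cm cn; apply: (@comp_ext _ _ _ _ (fun x => iter (m x) succn (n x))).
  by move=> x; elim: (m x) => //= k ->.
by apply: comp_iter; comp.
Qed.
#[global] Hint Resolve comp_addn : comp.

Lemma comp_muln {X : Type} {eX : Enc X} (m n : X -> nat) : comp m -> comp n -> comp (fun x => m x * n x)%N.
Proof.
move=> cm cn; apply: (@comp_ext _ _ _ _ (fun x => iter (m x) (addn (n x)) 0%N)).
  by move=> x; elim: (m x) => //= k ->.
by apply: comp_iter; comp.
Qed.
#[global] Hint Resolve comp_muln : comp.

Lemma comp_subn {X : Type} {eX : Enc X} (m n : X -> nat) : comp m -> comp n -> comp (fun x => m x - n x)%N.
Proof.
move=> cm cn; apply: (@comp_ext _ _ _ _ (fun x => iter (n x) predn (m x))).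
  by move=> x; rewrite iter_predn.
by apply: comp_iter; comp.
Qed.
#[global] Hint Resolve comp_subn : comp.

Lemma comp_leq {X : Type} {eX : Enc X} (m n : X -> nat) : comp m -> comp n -> comp (fun x => m x <= n x)%N.
Proof. by move=> cm cn; apply: comp_eqn0; comp. Qed.
#[global] Hint Resolve comp_leq : comp.

Lemma comp_eqn {X : Type} {eX : Enc X} (m n : X -> nat) : comp m -> comp n -> comp (fun x => m x == n x).
Proof.
move=> cm cn; apply: (@comp_ext _ _ _ _ (fun x => (m x <= n x) && (n x <= m x))%N).
  by move=> x; rewrite -eqn_leq.
by comp.
Qed.
#[global] Hint Resolve comp_eqn : comp.

Lemma comp_find {X Y : Type} {eX : Enc X} {eY : Enc Y}
    (P : X -> Y -> bool) (s : X -> seq Y) :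
  comp (fun z : X * Y => P z.1 z.2) -> comp s ->
  comp (fun x => find (P x) (s x)).
Proof.
move=> cP cs; apply: (@comp_ext _ _ _ _
  (fun x => foldr (fun y n => if P x y then 0%N else n.+1) 0%N (s x))) => [x|].
  by elim: (s x) => //= y l ->.
by comp.
Qed.
#[global] Hint Resolve comp_find : comp.

Lemma comp_size {X Y : Type} {eX : Enc X} {eY : Enc Y}
    (s : X -> seq Y) :
  comp s -> comp (fun x => size (s x)).
Proof.
move=> cs; apply: (@comp_ext _ _ _ _
  (fun x => foldr (fun y n => n.+1) 0%N (s x))); last by comp.
by move=> x; elim: (s x) => //= y l ->.
Qed.
#[global] Hint Resolve comp_size : comp.

Lemma comp_iota {X : Type} {eX : Enc X} (m n : X -> nat) : comp m -> comp n -> comp (fun x => iota (m x) (n x)).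
Proof.
move=> cm cn; apply: (@comp_ext _ _ _ _
  (fun x => iter (n x) (fun l => l ++ [:: m x + size l]%N) [::])); last by comp.
move=> x; elim: (n x) => // k IH.
by rewrite iterS IH size_iota -(addn1 k) iotaD.
Qed.
#[global] Hint Resolve comp_iota : comp.

Lemma comp_nth {X Y : Type} {eX : Enc X} {eY : Enc Y}
    (y : X -> Y) (s : X -> seq Y) (n : X -> nat) :
  comp y -> comp s -> comp n -> comp (fun x => nth (y x) (s x) (n x)).
Proof.
move=> cy cs cn; apply: (@comp_ext _ _ _ _
  (fun x => head (y x) (iter (n x) behead (s x)))) => [x|].
  rewrite -nth0 -[n x in RHS]addn0; elim: (n x) (s x) => [//|k IH] l.
  by rewrite iterSr IH; case: l => //=; rewrite nth_nil.
by apply: comp_head => //; apply: comp_iter; comp.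
Qed.
#[global] Hint Resolve comp_nth : comp.


(** Division and gcd are computed by bounded search for a least number. *)
Lemma find_iota (P : pred nat) (m n : nat) :
  (n < m)%N -> P n -> (forall k, (k < n)%N -> ~~ P k) ->
  find P (iota 0 m) = n.
Proof.
move=> lt_nm Pn minP; have hP : has P (iota 0 m).
  by apply/hasP; exists n; rewrite ?mem_iota.
have lt_fm : (find P (iota 0 m) < m)%N by rewrite -{2}(size_iota 0 m) -has_find.
apply/eqP; rewrite eqn_leq; apply/andP; split.
  rewrite leqNgt; apply/negP => /(before_find 0%N).
  by rewrite nth_iota // add0n Pn.
rewrite leqNgt; apply/negP => /minP /negP; apply.
by have := nth_find 0%N hP; rewrite nth_iota.
Qed.

Lemma comp_divn {X : Type} {eX : Enc X} (m n : X -> nat) : comp m -> comp n -> comp (fun x => m x %/ n x)%N.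
Proof.
(* The quotient is the least [q] with [m < (q + 1) n], and is at most [m]. For [n = 0] the search
   would fail and return its length, hence the separate case. *)
move=> cm cn; apply: (@comp_ext _ _ _ _ (fun x => if n x == 0%N then 0%N else
  find (fun q => m x < q.+1 * n x)%N (iota 0 (m x).+1))); last by comp.
move=> x; case: eqP => [->|/eqP n0]; first by rewrite divn0.
have n_gt0 : (0 < n x)%N by rewrite lt0n.
apply: find_iota => [||k lt_k]; first by rewrite ltnS leq_div.
  by rewrite ltn_ceil.
by rewrite -leqNgt (leq_trans _ (leq_trunc_div (m x) (n x))) // leq_mul2r lt_k orbT.
Qed.
#[global] Hint Resolve comp_divn : comp.

Lemma comp_dvdn {X : Type} {eX : Enc X} (m n : X -> nat) : comp m -> comp n -> comp (fun x => m x %| n x)%N.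
Proof.
move=> cm cn; apply: (@comp_ext _ _ _ _ (fun x => n x %/ m x * m x == n x)%N).
  by move=> x; rewrite dvdn_eq.
by comp.
Qed.
#[global] Hint Resolve comp_dvdn : comp.

Lemma comp_gcdn {X : Type} {eX : Enc X} (m n : X -> nat) : comp m -> comp n -> comp (fun x => gcdn (m x) (n x)).
Proof.
(* Candidates descend from [m + n], which bounds the gcd, so the first common divisor met is the
   greatest. If both numbers are 0, the first candidate is already 0. *)
move=> cm cn; apply: (@comp_ext _ _ _ _ (fun x => m x + n x -
   find (fun k => (m x + n x - k %| m x) && (m x + n x - k %| n x))
     (iota 0 (m x + n x).+1))%N); last by comp.
move=> x; move: (m x) (n x) => a b; have gab : (gcdn a b <= a + b)%N.
  case: (posnP a) => [->|a0]; first by rewrite gcd0n.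
  exact: leq_trans (dvdn_leq a0 (dvdn_gcdl a b)) (leq_addr _ _).
rewrite (@find_iota _ _ (a + b - gcdn a b)%N) ?subKn ?dvdn_gcdl ?dvdn_gcdr //.
  by rewrite ltnS leq_subr.
move=> k lt_k; rewrite -dvdn_gcd; apply/negP => /dvdn_leq.
case: (posnP (gcdn a b)) => [g0|g0 /(_ isT)]; last by lia.
by have := dvdn_gcdl a b; have := dvdn_gcdr a b; rewrite g0 !dvd0n; lia.
Qed.
#[global] Hint Resolve comp_gcdn : comp.


Local Open Scope ring_scope.

(* The hints match terms syntactically: [intZmod.addz], [addq] and the like are
   used below in place of the ring operations, whose types are projections of
   structures rather than [int] or [rat]. *)

(** * Integers and rationals *)

Section Int.
Context {X : Type} {eX : Enc X}.
Implicit Types (z : X -> int) (n : X -> nat).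

Lemma comp_ltz0 z : comp z -> comp (fun x => z x < 0).
Proof. by move=> [p pP]; exists (Seq p Hd) => x; apply: exec_seq (pP x) (exec_hd _). Qed.

Lemma comp_absz z : comp z -> comp (fun x => `|z x|%N).
Proof. by move=> [p pP]; exists (Seq p Tl) => x; apply: exec_seq (pP x) (exec_tl _). Qed.

Lemma comp_int_sign_abs z :
  comp (fun x => z x < 0) -> comp (fun x => `|z x|%N) -> comp z.
Proof. by move=> [p pP] [q qP]; exists (Defs.Cons p q) => x; apply: exec_cons. Qed.

End Int.
#[global] Hint Resolve comp_ltz0 comp_absz : comp.

Section IntArith.
Context {X : Type} {eX : Enc X}.
Implicit Types (y z : X -> int) (n : X -> nat).

Lemma comp_Posz n : comp n -> comp (fun x => Posz (n x)).
Proof. by move=> cn; apply: comp_int_sign_abs => //; apply: comp_const. Qed.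

Lemma comp_Negz n : comp n -> comp (fun x => Negz (n x)).
Proof.
move=> cn; apply: comp_int_sign_abs; first exact: comp_const.
exact: comp_succn cn.
Qed.

Lemma comp_addz y z : comp y -> comp z -> comp (fun x => intZmod.addz (y x) (z x)).
Proof.
rewrite -[intZmod.addz]/+%R.
move=> cy cz; apply: comp_int_sign_abs.
  apply: (@comp_ext _ _ _ _ (fun x =>
    if y x < 0 then (z x < 0) || (`|z x| < `|y x|)%N
    else (z x < 0) && (`|y x| < `|z x|)%N)); last by comp.
  by move=> x; case: ifP; lia.
apply: (@comp_ext _ _ _ _ (fun x =>
  if (y x < 0) == (z x < 0) then (`|y x| + `|z x|)%N
  else (`|y x| - `|z x| + (`|z x| - `|y x|))%N)); last by comp.
by move=> x; case: eqP; lia.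
Qed.

Lemma comp_mulz y z : comp y -> comp z -> comp (fun x => intRing.mulz (y x) (z x)).
Proof.
rewrite -[intRing.mulz]/*%R.
move=> cy cz; apply: comp_int_sign_abs.
  (* Zero counts as nonnegative, so factors of different signs have a negative product only if
     neither is 0. *)
  apply: (@comp_ext _ _ _ _ (fun x => ~~ ((y x < 0) == (z x < 0)) &&
    (~~ (`|y x|%N == 0%N) && ~~ (`|z x|%N == 0%N)))); last by comp.
  by move=> x; nia.
apply: (@comp_ext _ _ _ _ (fun x => `|y x| * `|z x|)%N); last by comp.
by move=> x; rewrite abszM.
Qed.

Lemma comp_eqz y z : comp y -> comp z -> comp (fun x => y x == z x).
Proof.
move=> cy cz; apply: (@comp_ext _ _ _ _ (fun x =>
  ((y x < 0) == (z x < 0)) && (`|y x|%N == `|z x|%N))); last by comp.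
by move=> x; lia.
Qed.

End IntArith.
#[global] Hint Resolve comp_Posz comp_Negz comp_addz comp_mulz comp_eqz : comp.

Section Rat.
Context {X : Type} {eX : Enc X}.

Lemma comp_numq (q : X -> rat) : comp q -> comp (fun x => numq (q x)).
Proof. by move=> [p pP]; exists (Seq p Hd) => x; apply: exec_seq (pP x) (exec_hd _). Qed.

Lemma comp_denq (q : X -> rat) : comp q -> comp (fun x => denq (q x)).
Proof. by move=> [p pP]; exists (Seq p Tl) => x; apply: exec_seq (pP x) (exec_tl _). Qed.

Lemma comp_rat_num_den (q : X -> rat) :
  comp (fun x => numq (q x)) -> comp (fun x => denq (q x)) -> comp q.
Proof. by move=> [p pP] [r rP]; exists (Defs.Cons p r) => x; apply: exec_cons. Qed.

Lemma comp_fracq (u v : X -> int) :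
  comp u -> comp v -> comp (fun x => fracq (u x, v x)).
Proof.
move=> cu cv; apply: comp_rat_num_den.
  (* The reduced denominator is positive, so the sign ([Negz 0] is -1) goes to the numerator; on a
     zero denominator [fracq] returns 0, that is, 0 over 1. *)
  apply: (@comp_ext X int _ _ (fun x => if v x == Posz 0 then Posz 0 else
    intRing.mulz (if (v x < 0) == (u x < 0) then Posz 1 else Negz 0)
      (Posz (`|u x| %/ gcdn `|u x| `|v x|)%N))); last by comp.
  move=> x; rewrite num_fracq /=; case: eqP => //= _.
  by case: (v x < 0); case: (u x < 0).
apply: (@comp_ext X int _ _ (fun x => if v x == Posz 0 then Posz 1 else
  Posz (`|v x| %/ gcdn `|u x| `|v x|)%N)); last by comp.
by move=> x; rewrite den_fracq /=; case: eqP.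
Qed.

End Rat.
#[global] Hint Resolve comp_numq comp_denq comp_fracq : comp.

Section RatArith.
Context {X : Type} {eX : Enc X}.
Implicit Types p q : X -> rat.

Lemma comp_addq p q : comp p -> comp q -> comp (fun x => addq (p x) (q x)).
Proof.
move=> cp cq; apply: (@comp_ext _ _ _ _ (fun x => fracq
  (intZmod.addz (intRing.mulz (numq (p x)) (denq (q x)))
     (intRing.mulz (numq (q x)) (denq (p x))),
   intRing.mulz (denq (p x)) (denq (q x))))); last by comp.
by move=> x; rewrite addq_def addq_subdefE.
Qed.

Lemma comp_mulq p q : comp p -> comp q -> comp (fun x => mulq (p x) (q x)).
Proof.
move=> cp cq; apply: (@comp_ext _ _ _ _ (fun x => fracq
  (intRing.mulz (numq (p x)) (numq (q x)),
   intRing.mulz (denq (p x)) (denq (q x))))); last by comp.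
by move=> x; rewrite mulq_def mulq_subdefE.
Qed.

Lemma comp_eqq p q : comp p -> comp q -> comp (fun x => p x == q x).
Proof.
move=> cp cq; apply: (@comp_ext _ _ _ _ (fun x =>
  (numq (p x) == numq (q x)) && (denq (p x) == denq (q x)))); last by comp.
by move=> x; rewrite rat_eqE.
Qed.

End RatArith.
#[global] Hint Resolve comp_addq comp_mulq comp_eqq : comp.

(** * The search program *)

(** The only unbounded loop: [k] runs up from 0 until [chk] accepts, so halting is claimed for the
    inputs that have an accepted [k]. Prepending [Leaf] to the unary counter increments it. *)
Lemma exec_search {X Y : Type} {eX : Enc X} {eY : Enc Y}
    (chk : X * nat -> bool) (out : X * nat -> Y) :
  comp chk -> comp out ->
  exists p, forall x, (exists k, chk (x, k)) ->
    exists2 k, chk (x, k) & exec p (encode x) (encode (out (x, k))).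
Proof.
move=> cc [po outP]; have [pc cP] : comp (fun z => ~~ chk z) by comp.
pose loop := While pc (Defs.Cons Hd (Defs.Cons Defs.Nil Tl)).
exists (Seq (Seq (Defs.Cons Id Defs.Nil) loop) po) => x ex.
case: (ex_minnP ex) => k kP kmin; exists k => //.
apply: exec_seq (outP _); apply: exec_seq.
  exact: exec_cons (exec_id _) (exec_nil _).
(* A [While] derivation is built from its end, so the induction is on the distance [j] to the least
   accepted [k]. *)
have loopP j : (j <= k)%N -> exec loop (encode (x, (k - j)%N)) (encode (x, k)).
  elim: j => [_|j IH lt_jk].
    rewrite subn0; apply: exec_while_false.
    by move: (cP (x, k)); rewrite kP.
  have Nchk : ~~ chk (x, (k - j.+1)%N).
    by apply: contraL lt_jk => /kmin; lia.
  have := cP (x, (k - j.+1)%N); rewrite Nchk => c_true.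
  apply: exec_while_true c_true _ (IH (ltnW lt_jk)).
  rewrite -(subnSK lt_jk); apply: exec_cons (exec_hd _) _.
  exact: exec_cons (exec_nil _) (exec_tl _).
by have := loopP k (leqnn k); rewrite subnn.
Qed.

Notation mat := (seq (seq rat)).

(** One program serves all dimensions, so it works on lists of rows with the size as a separate
    argument; missing entries read as 0. *)
Definition coef (l : mat) (i j : nat) : rat := nth zeroq (nth [::] l i) j.
Definition mx_of (n : nat) (l : mat) : 'M[rat]_n := \matrix_(i, j) coef l i j.

Definition tabulate (n : nat) (f : nat -> nat -> rat) : mat :=
  [seq [seq f i j | j <- iota 0 n] | i <- iota 0 n].
Definition all_entries (n : nat) (P : nat -> nat -> bool) : bool :=
  all (fun i => all (P i) (iota 0 n)) (iota 0 n).

Definition lone (n : nat) : mat :=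
  tabulate n (fun i j => if i == j then oneq else zeroq).
Definition lmul (n : nat) (A B : mat) : mat :=
  tabulate n (fun i j =>
    foldr (fun k s => addq (mulq (coef A i k) (coef B k j)) s) zeroq (iota 0 n)).
Definition leqm (n : nat) (A B : mat) : bool :=
  all_entries n (fun i j => coef A i j == coef B i j).
Definition lint (n : nat) (A : mat) : bool :=
  all_entries n (fun i j => denq (coef A i j) == Posz 1).

Section CompMat.
Context {X : Type} {eX : Enc X}.
Implicit Types (n i j : X -> nat) (A B : X -> mat).

Lemma comp_coef A i j : comp A -> comp i -> comp j ->
  comp (fun x => coef (A x) (i x) (j x)).
Proof. by move=> cA ci cj; apply: comp_nth; comp. Qed.

Lemma comp_tabulate n (f : X -> nat -> nat -> rat) : comp n ->
  comp (fun z : X * nat * nat => f z.1.1 z.1.2 z.2) ->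
  comp (fun x => tabulate (n x) (f x)).
Proof. by move=> cn cf; do 2!(apply: comp_map; last by comp). Qed.

Lemma comp_all_entries n (P : X -> nat -> nat -> bool) : comp n ->
  comp (fun z : X * nat * nat => P z.1.1 z.1.2 z.2) ->
  comp (fun x => all_entries (n x) (P x)).
Proof. by move=> cn cP; do 2!(apply: comp_all; last by comp). Qed.

End CompMat.
#[global] Hint Resolve comp_coef comp_tabulate comp_all_entries : comp.

Section CompMatOps.
Context {X : Type} {eX : Enc X}.
Implicit Types (n i j : X -> nat) (A B : X -> mat).

Lemma comp_lone n : comp n -> comp (fun x => lone (n x)).
Proof. by move=> cn; apply: comp_tabulate; comp. Qed.

Lemma comp_lmul n A B : comp n -> comp A -> comp B ->
  comp (fun x => lmul (n x) (A x) (B x)).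
Proof. by move=> cn cA cB; apply: comp_tabulate; comp. Qed.

Lemma comp_leqm n A B : comp n -> comp A -> comp B ->
  comp (fun x => leqm (n x) (A x) (B x)).
Proof. by move=> cn cA cB; apply: comp_all_entries; comp. Qed.

Lemma comp_lint n A : comp n -> comp A -> comp (fun x => lint (n x) (A x)).
Proof. by move=> cn cA; apply: comp_all_entries; comp. Qed.

End CompMatOps.
#[global] Hint Resolve comp_lone comp_lmul comp_leqm comp_lint : comp.

(** * Candidates, word balls and the acceptance test *)

Definition choices (T : Type) (n : nat) (L : seq T) : seq (seq T) :=
  iter n (fun LL => [seq x :: l | x <- L, l <- LL]) [:: [::]].
(** Contains every rational with numerator and denominator below [K] in absolute value; repetitions
    and the pairs with [b = 0], which give 0, are harmless. *)
Definition rats (K : nat) : seq rat :=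
  [seq fracq (Posz a, Posz b) | a <- iota 0 K, b <- iota 0 K] ++
  [seq fracq (Negz a, Posz b) | a <- iota 0 K, b <- iota 0 K].
Definition cand (n K : nat) : seq mat := choices n (choices n (rats K)).

(** Inverses are found among the candidates instead of being computed; [check] ensures that none is
    missing. *)
Definition gens (n K : nat) (S : seq mat) : seq mat :=
  S ++ [seq t <- cand n K | has (fun s => leqm n (lmul n s t) (lone n)) S].
Definition ball (n : nat) (G : seq mat) (N : nat) : seq mat :=
  iter N (fun L => L ++ [seq lmul n s w | s <- G, w <- L]) [:: lone n].
(** Membership in GL(n, Z) is tested by finding an integral inverse in the same list. A ball over a
    set of units closed under inversion is itself closed under inversion, so there nothing is lost
    ([mem_mglz]). *)
Definition glz (n : nat) (L : seq mat) : seq mat :=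
  [seq t <- L | lint n t &&
     has (fun u => lint n u && leqm n (lmul n t u) (lone n)) L].
(** The second component is the inverse of the conjugator. Testing the elements of [G] suffices
    because conjugation is multiplicative ([conj_in_GLZ]). *)
Definition conjugators (n K : nat) (G : seq mat) : seq (mat * mat) :=
  [seq gg <- [seq (g, g') | g <- cand n K, g' <- cand n K] |
     leqm n (lmul n gg.1 gg.2) (lone n) &&
     all (fun s => lint n (lmul n gg.2 (lmul n s gg.1))) G].

(* [K + K.+1] bounds the length of [v^-1 w] for [v] in the ball of radius [K]
   and [w] in the ball of radius [K.+1]. *)
Definition int_gens (n K : nat) (S : seq mat) : seq mat :=
  glz n (ball n (gens n K S) (K + K.+1)).

(** The finite certificate at bound [K]: the inverses of the generators are found, words of length
    at most [K + 1] factor as in Schreier's argument, and a conjugator is available. *)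
Definition check (n K : nat) (S : seq mat) : bool :=
  [&& all (fun s => has (fun t => leqm n (lmul n s t) (lone n)) (cand n K)) S,
      all (fun w => has (fun v => has (fun t => leqm n w (lmul n v t))
             (int_gens n K S)) (ball n (gens n K S) K))
        (ball n (gens n K S) K.+1)
    & (0 < size (conjugators n K (gens n K S)))%N].

(** Brings a list to the [n] by [n] shape of [enc_mx], so that its encoding depends only on
    [mx_of n A]. *)
Definition canon (n : nat) (A : mat) : mat := tabulate n (coef A).

Definition answer (n K : nat) (S : seq mat) : mat * seq mat :=
  (canon n (head ([::], [::]) (conjugators n K (gens n K S))).1,
   map (canon n) (int_gens n K S)).

Lemma comp_choices {X T : Type} {eX : Enc X} {eT : Enc T}
    (n : X -> nat) (L : X -> seq T) :
  comp n -> comp L -> comp (fun x => choices (n x) (L x)).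
Proof. by move=> cn cL; apply: comp_iter; comp. Qed.
#[global] Hint Resolve comp_choices : comp.

Lemma comp_rats {X : Type} {eX : Enc X} (K : X -> nat) :
  comp K -> comp (fun x => rats (K x)).
Proof. by move=> cK; apply: comp_cat; comp. Qed.
#[global] Hint Resolve comp_rats : comp.

Lemma comp_cand {X : Type} {eX : Enc X} (n K : X -> nat) :
  comp n -> comp K -> comp (fun x => cand (n x) (K x)).
Proof. by move=> cn cK; apply: comp_choices; comp. Qed.
#[global] Hint Resolve comp_cand : comp.

Section CompAlgo.
Context {X : Type} {eX : Enc X}.
Implicit Types (n K : X -> nat) (S G : X -> seq mat).

Lemma comp_gens n K S : comp n -> comp K -> comp S ->
  comp (fun x => gens (n x) (K x) (S x)).
Proof. by move=> cn cK cS; apply: comp_cat; comp. Qed.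

Lemma comp_ball n G K : comp n -> comp G -> comp K ->
  comp (fun x => ball (n x) (G x) (K x)).
Proof. by move=> cn cG cK; apply: comp_iter; comp. Qed.

Lemma comp_glz n G : comp n -> comp G -> comp (fun x => glz (n x) (G x)).
Proof. by move=> cn cG; apply: comp_filter; comp. Qed.

Lemma comp_conjugators n K G : comp n -> comp K -> comp G ->
  comp (fun x => conjugators (n x) (K x) (G x)).
Proof. by move=> cn cK cG; apply: comp_filter; comp. Qed.

Lemma comp_canon n (A : X -> mat) :
  comp n -> comp A -> comp (fun x => canon (n x) (A x)).
Proof. by move=> cn cA; apply: comp_tabulate; comp. Qed.

End CompAlgo.
#[global] Hint Resolve comp_gens comp_ball comp_glz comp_conjugators comp_canon : comp.

Lemma comp_int_gens {X : Type} {eX : Enc X} (n K : X -> nat) (S : X -> seq mat) :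
  comp n -> comp K -> comp S -> comp (fun x => int_gens (n x) (K x) (S x)).
Proof. by move=> cn cK cS; apply: comp_glz; comp. Qed.
#[global] Hint Resolve comp_int_gens : comp.

Lemma comp_check {X : Type} {eX : Enc X} (n K : X -> nat) (S : X -> seq mat) :
  comp n -> comp K -> comp S -> comp (fun x => check (n x) (K x) (S x)).
Proof. by move=> cn cK cS; apply: comp_andb; comp. Qed.

Lemma comp_answer {X : Type} {eX : Enc X} (n K : X -> nat) (S : X -> seq mat) :
  comp n -> comp K -> comp S -> comp (fun x => answer (n x) (K x) (S x)).
Proof. by move=> cn cK cS; apply: comp_pair; comp. Qed.
#[global] Hint Resolve comp_check comp_answer : comp.

Lemma exec_answer :
  exists p, forall n S (d : nat), (exists K, check n K S) ->
    exists2 K, check n K S &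
      exec p (encode (n, (S, d))) (encode (answer n K S)).
Proof.
have cc : comp (fun z : nat * (seq mat * nat) * nat => check z.1.1 z.2 z.1.2.1).
  by comp.
have ca : comp (fun z : nat * (seq mat * nat) * nat => answer z.1.1 z.2 z.1.2.1).
  by comp.
by have [p pP] := exec_search cc ca; exists p => n S d; apply: (pP (n, (S, d))).
Qed.

(** * Lists of lists as matrices *)

Lemma eq_enc_seq (T : Type) (e e' : T -> tree) (s : seq T) :
  e =1 e' -> enc_seq e s = enc_seq e' s.
Proof. by move=> ee'; elim: s => //= x s ->; rewrite ee'. Qed.

Lemma encode_map {T U : Type} {eU : Enc U} (f : T -> U) (s : seq T) :
  encode (map f s) = enc_seq (fun x => encode (f x)) s.
Proof. by elim: s => //= x s <-. Qed.

Section Semantics.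
Variable n : nat.
Implicit Types (A B : mat) (M N : 'M[rat]_n).

Definition intmx M : bool := [forall i, forall j, M i j \is a Num.int].

Definition list_of M : mat := [seq [seq M i j | j <- enum 'I_n] | i <- enum 'I_n].

Lemma all_entriesP (P : nat -> nat -> bool) :
  reflect (forall i j : 'I_n, P i j) (all_entries n P).
Proof.
apply: (iffP allP) => [PP i j|PP i].
  have i_n : val i \in iota 0 n by rewrite mem_iota /=.
  by apply: (allP (PP _ i_n)); rewrite mem_iota /=.
rewrite mem_iota => /= lt_i.
by apply/allP => j; rewrite mem_iota => /= lt_j; apply: (PP (Ordinal lt_i) (Ordinal lt_j)).
Qed.

Lemma coef_tabulate f (i j : 'I_n) : coef (tabulate n f) i j = f i j.
Proof. by rewrite /coef (nth_map 0%N) ?size_iota // (nth_map 0%N) ?size_iota // !nth_iota. Qed.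

Lemma tabulate_list_of f :
  tabulate n f = list_of (\matrix_(i < n, j < n) f (val i) (val j)).
Proof.
rewrite /tabulate -val_enum_ord -map_comp; apply: eq_map => i /=.
by rewrite -map_comp; apply: eq_map => j /=; rewrite mxE.
Qed.

Lemma list_ofK : cancel list_of (mx_of n).
Proof.
(* The entries are extended by 0 to all pairs of naturals, which gives [list_of M] the form
   [tabulate], whose coefficients are known. *)
move=> M; have -> : list_of M =
    tabulate n (fun i j => if insub i is Some i' then
      if insub j is Some j' then M i' j' else 0 else 0).
  rewrite tabulate_list_of; congr list_of; apply/matrixP => i j.
  by rewrite mxE !valK.
by apply/matrixP => i j; rewrite mxE coef_tabulate !valK.
Qed.

Lemma mx_of_lone : mx_of n (lone n) = 1%:M.
Proof. by apply/matrixP => i j; rewrite !mxE coef_tabulate -val_eqE; case: eqP. Qed.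

Lemma mx_of_lmul A B : mx_of n (lmul n A B) = mx_of n A *m mx_of n B.
Proof.
apply/matrixP => i j; rewrite !mxE coef_tabulate.
rewrite -val_enum_ord foldr_map -big_enum.
by elim: (enum _) => [|k l IH]; rewrite /= ?big_nil ?big_cons ?IH ?mxE.
Qed.

Lemma leqmE A B : leqm n A B = (mx_of n A == mx_of n B).
Proof.
apply/all_entriesP/eqP => [eqAB|eqAB i j].
  by apply/matrixP => i j; rewrite !mxE; apply/eqP.
by move/matrixP: eqAB => /(_ i j); rewrite !mxE => ->.
Qed.

Lemma lintE A : lint n A = intmx (mx_of n A).
Proof.
apply/all_entriesP/forallP => [intA i|intA i j].
  by apply/forallP => j; rewrite mxE Qint_def.
by have /forallP/(_ j) := intA i; rewrite mxE Qint_def.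
Qed.

Lemma enc_list_of M : encode (list_of M) = enc_mx M.
Proof.
rewrite /enc_mx /list_of [LHS]encode_map; apply: eq_enc_seq => i.
exact: encode_map.
Qed.

Lemma enc_canon A : encode (canon n A) = enc_mx (mx_of n A).
Proof. by rewrite /canon tabulate_list_of enc_list_of. Qed.

Lemma enc_list_of_seq (S : seq 'M[rat]_n) :
  encode (map list_of S) = enc_seq (@enc_mx n) S.
Proof. by rewrite encode_map; apply: eq_enc_seq => M; apply: enc_list_of. Qed.

Lemma enc_canon_seq (S : seq mat) :
  encode (map (canon n) S) = enc_seq (@enc_mx n) (map (mx_of n) S).
Proof.
by rewrite encode_map /enc_seq foldr_map; apply: eq_enc_seq => A; apply: enc_canon.
Qed.

End Semantics.

Lemma choicesP (T : eqType) (n : nat) (L : seq T) (l : seq T) :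
  (l \in choices n L) = (size l == n) && all (mem L) l.
Proof.
elim: n l => [|n IH] l; first by rewrite inE; case: l.
apply/allpairsP/idP => [[[x u] /= [Lx u_n ->]]|] /=.
  by move: u_n; rewrite IH => /andP[/eqP -> ->]; rewrite eqxx Lx.
case: l => // x l /=; rewrite eqSS => /andP[sz /andP[Lx Ll]].
by exists (x, l); split=> //; rewrite IH sz.
Qed.

Lemma rats_mem (q : rat) (K : nat) :
  (`|numq q| < K)%N -> (`|denq q| < K)%N -> q \in rats K.
Proof.
move=> ltn ltd; rewrite mem_cat -[q]valqK /=.
have vq : valq q = (numq q, Posz `|denq q|).
  by rewrite absz_denq; case: q {ltn ltd} => [[]].
rewrite vq; case: (numq q) ltn => a lta; apply/orP; [left|right];
  apply/allpairsP; exists (a, `|denq q|%N); split=> //=; rewrite mem_iota //=.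
(* [Negz a] has absolute value [a.+1], so the bound on the numerator is one better than required. *)
exact: ltnW.
Qed.

Lemma cand_mem (n : nat) (M : 'M[rat]_n) :
  exists K0, forall K, (K0 <= K)%N -> list_of M \in cand n K.
Proof.
exists (\max_i \max_j (maxn `|numq (M i j)| `|denq (M i j)|)).+1 => K leK.
rewrite choicesP size_map size_enum_ord eqxx; apply/allP => r /mapP[i _ ->] /=.
rewrite choicesP size_map size_enum_ord eqxx; apply/allP => q /mapP[j _ ->] /=.
have lt_max : (maxn `|numq (M i j)| `|denq (M i j)| < K)%N.
  apply: leq_ltn_trans leK; apply: leq_trans (leq_bigmax i).
  exact: (leq_bigmax (F := fun j => maxn `|numq (M i j)| `|denq (M i j)|) j).
by apply: rats_mem; apply: leq_ltn_trans lt_max; rewrite ?leq_maxl ?leq_maxr.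
Qed.

(** * Cosets and conjugators *)

Section Lattices.
Variable n : nat.
Implicit Types (M N g h w : 'M[rat]_n) (H : 'M[rat]_n -> Prop).

Lemma intmxP M : reflect (is_int_mx M) (intmx M).
Proof.
apply: (iffP idP) => [/forallP intM|[B ->]].
  exists (\matrix_(i, j) numq (M i j)); apply/matrixP => i j.
  by rewrite !mxE numqK //; apply: (forallP (intM i)).
by apply/forallP => i; apply/forallP => j; rewrite mxE intr_int.
Qed.

Lemma intmxM M N : intmx M -> intmx N -> intmx (M *m N).
Proof.
by move=> /intmxP[A ->] /intmxP[B ->]; apply/intmxP; exists (A *m B); rewrite map_mxM.
Qed.

Lemma intmxD M N : intmx M -> intmx N -> intmx (M + N).
Proof.
by move=> /intmxP[A ->] /intmxP[B ->]; apply/intmxP; exists (A + B); rewrite map_mxD.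
Qed.

Lemma intmxZ (z : int) M : intmx M -> intmx (z%:~R *: M).
Proof.
move=> /intmxP[A ->]; apply/intmxP; exists (z *: A).
by apply/matrixP => i j; rewrite !mxE intrM.
Qed.

Lemma intmx1 : intmx (1%:M : 'M_n).
Proof. by apply/intmxP; exists 1%:M; rewrite map_mx1. Qed.

Lemma intmx_delta i j : intmx (delta_mx i j : 'M_n).
Proof. by apply/intmxP; exists (delta_mx i j); rewrite map_delta_mx. Qed.

(** Over a commutative ring a right inverse is two-sided, so an integral right inverse certifies
    invertibility over the integers. *)
Lemma in_GLZP M : in_GLZ M <-> exists N, [/\ intmx M, intmx N & M *m N = 1%:M].
Proof.
split=> [[B uB ->]|[N [/intmxP[A ->] /intmxP[B ->]]]].
  exists (map_mx intr (invmx B)); split; try by apply/intmxP; eexists.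
  by rewrite -map_mxM mulmxV // map_mx1.
rewrite -map_mxM => AB1; exists A => //.
suff /mulmx1_unit[] : A *m B = 1%:M by [].
apply/matrixP => i j; apply: (@intr_inj rat).
by move/matrixP: AB1 => /(_ i j); rewrite !mxE => ->; case: (i == j).
Qed.

(* [1 + A *m delta_mx j i - ...] replaces column [i] of the identity by column
   [j] of [A] minus an integer multiple of the [i]-th basis vector. *)
Lemma det_replace_col (A : 'M[rat]_n) (c : rat) i j :
  \det (1%:M + A *m delta_mx j i + (- (1 + c)) *: delta_mx i i) = A i j - c.
Proof.
set E := _ + _; have colE k : E k i = A k j - c * (k == i)%:R.
  rewrite !mxE (bigD1 j) //= big1 => [|l lj]; last first.
    by rewrite !mxE (negPf lj) mulr0.
  by rewrite !mxE !eqxx andbT /=; case: (k == i); ring.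
(* [E] and the identity agree off column [i], so their cofactors along that column coincide and the
   expansion reduces to the entry [E i i]. *)
have cofE k : cofactor E k i = cofactor 1%:M k i.
  rewrite /cofactor; congr (_ * \det _); apply/matrixP => a b; rewrite !mxE.
  have -> : (lift i b == i) = false by rewrite eq_sym (negPf (neq_lift _ _)).
  rewrite big1 => [|l _]; first by rewrite andbF mulr0 !addr0.
  by rewrite !mxE [lift i b == i]eq_sym (negPf (neq_lift _ _)) andbF mulr0.
rewrite (expand_det_col _ i) (eq_bigr (fun k => E k i * (i == k)%:R)).
  rewrite (bigD1 i) //= big1 => [|k ki]; last by rewrite eq_sym (negPf ki) mulr0.
  by rewrite colE !eqxx !mulr1 addr0.
move=> k _; rewrite cofE; congr (_ * _).
by have /matrixP/(_ i k) := adj1 rat n; rewrite !mxE.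
Qed.

(* Among the nonsingular matrices [g] all of whose translates [h g] are
   integral, one of minimal [|det g|] has all [g^-1 h g] integral: otherwise
   subtracting an integer from a non-integral entry yields a smaller one. *)
Lemma integral_conjugator H d :
  H 1%:M -> (forall M N, H M -> H N -> H (M *m N)) -> common_denominator H d ->
  exists2 g, g \in unitmx & forall h, H h -> intmx (invmx g *m h *m g).
Proof.
move=> H1 HM [d_gt0 Hd].
suff descent k g : `|numq (\det g)|%N = k -> g \in unitmx ->
    (forall h, H h -> intmx (h *m g)) ->
    exists2 g, g \in unitmx & forall h, H h -> intmx (invmx g *m h *m g).
  (* The descent starts at [d] times the identity, whose translates are the matrices [d h]. *)
  apply: (descent _ (d%:R%:M : 'M_n)) => // [|h Hh].
    by rewrite unitmxE det_scalar unitfE expf_neq0 // pnatr_eq0 -lt0n.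
  by rewrite mul_mx_scalar; apply/intmxP/Hd.
elim/ltn_ind: k g => k IH g det_g unit_g int_g.
case: (classic (forall h, H h -> intmx (invmx g *m h *m g))) => [|not_int].
  by exists g.
have [h Hh [i [j A_ij]]] : exists2 h, H h &
    exists i j, (invmx g *m h *m g) i j \isn't a Num.int.
  apply: NNPP => no; apply: not_int => h Hh; apply/forallP => i.
  by apply/forallP => j; apply: contra_notT no => nint; exists h => //; exists i, j.
have : g *m (invmx g *m h *m g) = h *m g by rewrite !mulmxA mulmxV // mul1mx.
move: (invmx g *m h *m g) A_ij => A A_ij gA.
pose c := Num.floor (A i j).
(* [\det E] is the fractional part of [A i j], hence strictly between 0 and 1, so passing from [g]
   to [g *m E] decreases the absolute value of the determinant. *)
pose E := 1%:M + A *m delta_mx j i + (- (1 + c))%:~R *: delta_mx i i.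
have detE : \det E = A i j - c%:~R.
  by rewrite /E rmorphN rmorphD det_replace_col.
have detE_gt0 : 0 < \det E.
  by rewrite detE subr_gt0 lt_neqAle floor_le andbT -intrEfloor.
have detE_lt1 : \det E < 1.
  by rewrite detE ltrBlDr addrC -[1]/(1%:~R) -intrD floorD1_gt.
have unit_E : E \in unitmx by rewrite unitmxE unitfE gt_eqF.
have int_gE h' : H h' -> intmx (h' *m (g *m E)).
  (* Since [g A = h g], the product [h' g A] is [(h' h) g], which is integral because [h' h] lies in
     [H]. *)
  move=> Hh'; have hhg := int_g _ (HM _ _ Hh' Hh); rewrite -mulmxA -gA in hhg.
  rewrite /E !mulmxDr mulmx1 -!scalemxAr -?scalemxAr !mulmxA.
  apply: intmxD; [apply: intmxD|]; first exact: int_g.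
    by apply: intmxM (intmx_delta _ _); rewrite -mulmxA.
  by apply: intmxZ; apply: intmxM (intmx_delta _ _); apply: int_g.
(* Taking [h = 1] shows that [g'] itself is integral, so its determinant is an integer and the
   induction measure is its absolute value. *)
have intdet g' : (forall h, H h -> intmx (h *m g')) ->
    \det g' = (numq (\det g'))%:~R.
  move=> /(_ _ H1); rewrite mul1mx => /intmxP[B ->].
  by rewrite det_map_mx numq_int.
suff lt_det : (`|numq (\det (g *m E))| < k)%N.
  by apply: (IH _ lt_det (g *m E)); rewrite // unitmx_mul unit_g.
rewrite -det_g -ltz_nat !abszE -(ltr_int rat) !intr_norm -!intdet //.
rewrite det_mulmx normrM gtr_pMr ?normr_gt0; first by rewrite gtr0_norm.
by rewrite -unitfE -unitmxE.
Qed.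

(** The class of [d M] modulo [d ^ 2], entry by entry. The bound is written as a successor to suit
    [inord]. *)
Definition residue (d : nat) M : {ffun 'I_n * 'I_n -> 'I_(d ^ 2).-1.+1} :=
  [ffun ij => inord `|(numq (d%:R * M ij.1 ij.2) %% (d ^ 2)%N)%Z|%N].

Lemma residue_eq d M N : (0 < d)%N ->
  is_int_mx (d%:R *: M) -> is_int_mx (d%:R *: N) -> residue d M = residue d N ->
  exists2 D, intmx D & M - N = d%:R *: D.
Proof.
move=> d_gt0 /intmxP intM /intmxP intN /ffunP eqMN.
exists (d%:R^-1 *: (M - N)); last first.
  by rewrite scalerA divff ?scale1r // pnatr_eq0 -lt0n.
apply/forallP => i; apply/forallP => j.
have := eqMN (i, j); rewrite !ffunE /=.
have /forallP/(_ j) := forallP intM i; have /forallP/(_ j) := forallP intN i.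
rewrite !mxE => /intrP[b Nb] /intrP[a Ma]; rewrite Ma Nb !numq_int.
have d2 : (0 < (d ^ 2)%N :> int)%R by rewrite ltz_nat expn_gt0 d_gt0.
have small (z : int) : (`|(z %% (d ^ 2)%N)%Z| < (d ^ 2).-1.+1)%N.
  rewrite prednK ?expn_gt0 ?d_gt0 // -ltz_nat gez0_abs ?modz_ge0 ?gt_eqF //.
  exact: ltz_pmod.
move=> /(congr1 val); rewrite /= !inordK // => /(congr1 Posz).
rewrite !gez0_abs ?modz_ge0 ?gt_eqF // => /eqP.
rewrite eqz_mod_dvd => /dvdzP[q def_q].
have dN0 : d%:R != 0 :> rat by rewrite pnatr_eq0 -lt0n.
suff -> : d%:R^-1 * (M i j - N i j) = q%:~R by apply: intr_int.
apply: (mulfI dN0); apply: (mulfI dN0); rewrite mulVKf // mulrBr Ma Nb -intrB def_q.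
by rewrite intrM -pmulrn natrX; ring.
Qed.

(** If [h1] and [h2] have the same residue, then [h2 = h1 + d D] with [D] integral, so
    [h1^-1 h2 = 1 + (d h1^-1) D] is integral, and by symmetry so is its inverse. There are finitely
    many residues, and each one that occurs in [H] is represented in some [L k]. *)
Lemma finitely_many_cosets H (L : nat -> seq 'M[rat]_n) d :
  (forall M, H M -> M \in unitmx) -> (forall M, H M -> H (invmx M)) ->
  common_denominator H d ->
  (forall k M, M \in L k -> H M) -> (forall M, H M -> exists k, M \in L k) ->
  (forall k l M, (k <= l)%N -> M \in L k -> M \in L l) ->
  exists k, forall h, H h -> exists2 w, w \in L k & in_GLZ (invmx w *m h).
Proof.
move=> Hunit HV [d_gt0 Hd] LH HL Lmono.
have rep r : exists k, forall h, H h -> residue d h = r ->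
    exists2 w, w \in L k & residue d w = r.
  case: (classic (exists2 h, H h & residue d h = r)) => [[h Hh <-]|no].
    by have [k Lk] := HL _ Hh; exists k => *; exists h.
  by exists 0%N => h Hh hr; case: no; exists h.
have {rep} [f fP] := fin_all_exists rep.
exists (\max_r f r) => h Hh; have [w Lw res_w] := fP _ _ Hh erefl.
exists w; first by apply: Lmono Lw; apply: leq_bigmax.
have Hw := LH _ _ Lw.
have int_coset h1 h2 : H h1 -> H h2 -> residue d h1 = residue d h2 ->
    intmx (invmx h1 *m h2).
  move=> H1 H2 eq12; have [D intD h21] :=
    residue_eq d_gt0 (Hd _ H2) (Hd _ H1) (esym eq12).
  have -> : h2 = h1 + d%:R *: D by rewrite -h21 addrC subrK.
  rewrite mulmxDr mulVmx ?Hunit // -scalemxAr scalemxAl.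
  by apply: intmxD intmx1 _; apply: intmxM intD; apply/intmxP/Hd/HV.
apply/in_GLZP; exists (invmx h *m w); split; [exact: int_coset|exact: int_coset|].
by rewrite -mulmxA mulKVmx ?Hunit // mulVmx ?Hunit.
Qed.

End Lattices.

(** * Word balls *)

Lemma invmx_uniq (n : nat) (M N : 'M[rat]_n) : M *m N = 1%:M -> invmx M = N.
Proof. by move=> MN; have [uM _] := mulmx1_unit MN; rewrite -[N](mulKmx uM) MN mulmx1. Qed.

Section Balls.
Variable n : nat.
Implicit Types (M N h s t u v w : 'M[rat]_n) (G L S T : seq 'M[rat]_n) (k l : nat).

(** The counterparts of [ball], [glz] and [gens] on genuine matrices, where the group theory takes
    place. *)
Definition mball G k : seq 'M[rat]_n :=
  iter k (fun L => L ++ [seq s *m w | s <- G, w <- L]) [:: 1%:M].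
Definition mglz L : seq 'M[rat]_n :=
  [seq t <- L | intmx t && has (fun u => intmx u && (t *m u == 1%:M)) L].
Definition with_inverses S : seq 'M[rat]_n := S ++ map (@invmx _ n) S.

Lemma mx_of_ball (G : seq mat) k :
  map (mx_of n) (ball n G k) = mball (map (mx_of n) G) k.
Proof.
elim: k => [|k IH] /=; first by rewrite mx_of_lone.
rewrite map_cat IH map_allpairs -IH allpairs_mapl allpairs_mapr; congr cat.
by apply: eq_allpairs => s w; rewrite mx_of_lmul.
Qed.

Lemma mx_of_glz (L : seq mat) :
  map (mx_of n) (glz n L) = mglz (map (mx_of n) L).
Proof.
rewrite /mglz filter_map; congr map; apply: eq_filter => t /=.
rewrite lintE has_map; congr andb; apply: eq_has => u /=.
by rewrite lintE leqmE mx_of_lmul mx_of_lone.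
Qed.

Lemma mballS G k M :
  reflect (M \in mball G k \/ exists s w, [/\ s \in G, w \in mball G k & M = s *m w])
    (M \in mball G k.+1).
Proof.
rewrite mem_cat; apply: (iffP orP) => -[]; try by left.
  by case/allpairsP => -[s w] [Gs Lw ->]; right; exists s, w.
by case=> s [w [Gs Lw ->]]; right; apply/allpairsP; exists (s, w).
Qed.

Lemma mball_mono G k l M : (k <= l)%N -> M \in mball G k -> M \in mball G l.
Proof.
move=> /subnK <-; elim: (l - k)%N => // m IH Mk.
by apply/mballS; left; apply: IH.
Qed.

Lemma mball1 G k : 1%:M \in mball G k.
Proof. by apply: (mball_mono (leq0n k)); rewrite inE. Qed.

Lemma mball_gen G s : s \in G -> s \in mball G 1.
Proof.
by move=> Gs; apply/mballS; right; exists s, 1%:M; rewrite mulmx1 mball1.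
Qed.

Lemma mball_mul G k l M N :
  M \in mball G k -> N \in mball G l -> M *m N \in mball G (k + l).
Proof.
elim: k M => [|k IH] M; first by rewrite inE => /eqP ->; rewrite mul1mx.
move=> /mballS[Mk|[s [w [Gs wk ->]]]] Nl; rewrite addSn; apply/mballS.
  by left; apply: IH.
by right; exists s, (w *m N); rewrite mulmxA IH.
Qed.

(** Lets [gens] replace [with_inverses], although the two may differ in order and repetitions. *)
Lemma eq_mball G G' k : G =i G' -> mball G k =i mball G' k.
Proof.
move=> eqG; elim: k => // k IH M.
by apply/mballS/mballS; rewrite IH => -[|[s [w]]]; try (by left);
  rewrite ?eqG ?IH => H; right; exists s, w; rewrite ?eqG ?IH // -?eqG -?IH.
Qed.

Lemma eq_mglz L L' : L =i L' -> mglz L =i mglz L'.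
Proof. by move=> eqL M; rewrite !mem_filter eqL (eq_has_r eqL). Qed.

Lemma mball_inv G k M : (forall s, s \in G -> s \in unitmx) ->
  (forall s, s \in G -> invmx s \in G) -> M \in mball G k ->
  M \in unitmx /\ invmx M \in mball G k.
Proof.
move=> Gunit GV; elim: k M => [|k IH] M.
  by rewrite inE => /eqP ->; rewrite unitmx1 invmx1 inE.
move=> /mballS[/IH[uM VM]|[s [w [Gs /IH[uw Vw] ->]]]].
  by split=> //; apply: mball_mono VM.
rewrite unitmx_mul Gunit // uw; split=> //.
(* The inverse [w^-1 s^-1] has the new generator on the right, hence a product of balls of radii [k]
   and 1. *)
rewrite (@invmx_uniq _ _ (invmx w *m invmx s)).
  by rewrite -addn1; apply: mball_mul Vw _; apply/mball_gen/GV.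
by rewrite mulmxA mulmxK // mulmxV // Gunit.
Qed.

Lemma mem_mglz G k M : (forall s, s \in G -> s \in unitmx) ->
  (forall s, s \in G -> invmx s \in G) ->
  M \in mglz (mball G k) <-> M \in mball G k /\ in_GLZ M.
Proof.
move=> Gunit GV; rewrite mem_filter; split=> [/andP[/andP[intM /hasP[u _]]]|].
  by case/andP=> intu /eqP Mu Mk; split=> //; apply/in_GLZP; exists u.
case=> Mk /in_GLZP[u [intM intu Mu1]]; rewrite Mk intM andbT /=; apply/hasP.
have [uM VM] := mball_inv Gunit GV Mk; exists u; last by rewrite intu Mu1 eqxx.
by rewrite -(invmx_uniq Mu1).
Qed.

End Balls.

(** * The group generated by [S], its integral part and its conjugates *)

Section Groups.
Variables (n : nat) (S : seq 'M[rat]_n).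
Hypothesis Sunit : forall s, s \in S -> s \in unitmx.
Implicit Types (M N h s t u v w : 'M[rat]_n) (T : seq 'M[rat]_n) (k l : nat).

Let G := with_inverses S.

Lemma with_inverses_unit s : s \in G -> s \in unitmx.
Proof.
by rewrite mem_cat => /orP[/Sunit //|/mapP[t /Sunit ut ->]]; rewrite unitmx_inv.
Qed.

Lemma with_inverses_inv s : s \in G -> invmx s \in G.
Proof.
rewrite !mem_cat => /orP[Ss|/mapP[t St ->]]; last by rewrite invmxK St.
by rewrite map_f ?orbT.
Qed.

Let Gunit := with_inverses_unit.
Let GV := with_inverses_inv.

Lemma gen_group_mball M : gen_group S M <-> exists k, M \in mball G k.
Proof.
split=> [|[k]].
  elim=> {M} [M SM||M N _ [k Mk] _ [l Nl]|M _ [k Mk]].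
  - by exists 1%N; apply: mball_gen; rewrite mem_cat SM.
  - by exists 0%N; apply: mball1.
  - by exists (k + l)%N; apply: mball_mul.
  - by exists k; case: (mball_inv Gunit GV Mk).
elim: k M => [|k IH] M; first by rewrite inE => /eqP ->; apply: gen_group_1.
move=> /mballS[/IH //|[s [w [Gs /IH Hw ->]]]]; apply: gen_group_mul Hw.
move: Gs; rewrite mem_cat => /orP[|/mapP[t St ->]]; first exact: gen_group_mem.
exact/gen_group_inv/gen_group_mem.
Qed.

Lemma gen_group_unit M : gen_group S M -> M \in unitmx.
Proof. by move=> /gen_group_mball[k /(mball_inv Gunit GV)[]]. Qed.

Lemma in_GLZ_1 : in_GLZ (1%:M : 'M[rat]_n).
Proof. by apply/in_GLZP; exists 1%:M; rewrite intmx1 mulmx1. Qed.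

Lemma in_GLZ_mul M N : in_GLZ M -> in_GLZ N -> in_GLZ (M *m N).
Proof.
by move=> [A uA ->] [B uB ->]; exists (A *m B); rewrite ?map_mxM // unitmx_mul uA.
Qed.

Lemma in_GLZ_inv M : in_GLZ M -> in_GLZ (invmx M).
Proof.
move=> /in_GLZP[N [intM intN MN]]; apply/in_GLZP; exists M.
by rewrite (invmx_uniq MN); split=> //; apply: mulmx1C.
Qed.

(* By induction on the length every [h] in [<S>] is [v *m t] with [v] in the
   ball of radius [k] and [t] in [<T>]; if [h] is integral, so is [v]. *)
Lemma int_part_generated k T :
  T =i mglz (mball G (k + k.+1)) ->
  (forall w, w \in mball G k.+1 -> exists v t,
     [/\ v \in mball G k, t \in T & w = v *m t]) ->
  forall h, gen_group T h <-> int_part (gen_group S) h.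
Proof.
move=> defT step h.
have TP t : t \in T <-> t \in mball G (k + k.+1) /\ in_GLZ t.
  by rewrite defT; apply: mem_mglz.
split=> [|[/gen_group_mball[l hl] hZ]].
  elim=> {h} [t /TP[tk tZ]||M N _ [HM MZ] _ [HN NZ]|M _ [HM MZ]].
  - by split=> //; apply/gen_group_mball; eexists; apply: tk.
  - by split; [apply: gen_group_1|apply: in_GLZ_1].
  - by split; [apply: gen_group_mul|apply: in_GLZ_mul].
  - by split; [apply: gen_group_inv|apply: in_GLZ_inv].
have [v [t [vk Tt def_h]]] :
    exists v t, [/\ v \in mball G k, gen_group T t & h = v *m t].
  elim: l h hl {hZ} => [|l IH] h.
    rewrite inE => /eqP ->; exists 1%:M, 1%:M; rewrite mulmx1 mball1.
    by split=> //; apply: gen_group_1.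
  move=> /mballS[/IH //|[s [w [Gs /IH[v [t [vk Tt ->]]] ->]]]].
  (* The word [s v] has length at most [k + 1], so it equals [v' t'], and [s v t = v' (t' t)]. *)
  have [|v' [t' [vk' Tt' sv]]] := step (s *m v).
    by apply/mballS; right; exists s, v.
  exists v', (t' *m t); split=> //; last by rewrite !mulmxA sv.
  exact: gen_group_mul (gen_group_mem Tt') Tt.
have tZ : in_GLZ t.
  elim: {def_h} Tt => {t} [t /TP[] //||M N _ MZ _ NZ|M _ MZ].
  - exact: in_GLZ_1.
  - exact: in_GLZ_mul.
  - exact: in_GLZ_inv.
have ut : t \in unitmx by case/in_GLZP: tZ => u [_ _ /mulmx1_unit[]].
(* [v = h t^-1] lies in GL(n, Z) and has length at most [k], so it is already a member of [T]. *)
rewrite def_h; apply: gen_group_mul Tt; apply: gen_group_mem; apply/TP; split.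
  by apply: mball_mono vk; apply: leq_addr.
have -> : v = h *m invmx t by rewrite def_h -mulmxA mulmxV // mulmx1.
by apply: in_GLZ_mul hZ (in_GLZ_inv tZ).
Qed.

(** Conjugation by [g] is multiplicative, so the elements of [G] suffice; the conjugate of [s] has
    the conjugate of [s^-1] as inverse, also integral because [G] is closed under inversion. *)
Lemma conj_in_GLZ g : g \in unitmx ->
  (forall s, s \in G -> intmx (invmx g *m (s *m g))) ->
  forall h, gen_group S h -> in_GLZ (invmx g *m h *m g).
Proof.
move=> ug intG h.
have conjM M N : invmx g *m (M *m N) *m g =
    (invmx g *m M *m g) *m (invmx g *m N *m g).
  by rewrite !mulmxA mulmxK.
have conj1 : invmx g *m 1%:M *m g = 1%:M by rewrite mulmx1 mulVmx.
have Gk s : s \in G -> in_GLZ (invmx g *m s *m g).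
  move=> Gs; apply/in_GLZP; exists (invmx g *m invmx s *m g).
  rewrite -conjM mulmxV ?Gunit // conj1.
  by split=> //; rewrite -mulmxA; apply: intG => //; apply: GV.
move=> /gen_group_mball[k]; elim: k h => [|k IH] h.
  by rewrite inE => /eqP ->; rewrite conj1; apply: in_GLZ_1.
move=> /mballS[/IH //|[s [w [Gs /IH wZ ->]]]].
by rewrite conjM; apply: in_GLZ_mul (Gk _ Gs) wZ.
Qed.

(** Take [v] of length at most [k0] in the left coset of [w]; then [t = v^-1 w] is in GL(n, Z) and
    has length at most [k + (k + 1)]. Having this for all [k] from [k0] on lets it be combined with
    the other demands on the search bound. *)
Lemma words_reduce d : common_denominator (gen_group S) d ->
  exists k0, forall k w, (k0 <= k)%N -> w \in mball G k.+1 -> exists v t,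
    [/\ v \in mball G k, t \in mglz (mball G (k + k.+1)) & w = v *m t].
Proof.
move=> Hd.
have [k0 k0P] : exists k, forall h, gen_group S h ->
    exists2 w, w \in mball G k & in_GLZ (invmx w *m h).
  apply: (finitely_many_cosets gen_group_unit _ Hd).
  - exact: gen_group_inv.
  - by move=> k M Mk; apply/gen_group_mball; exists k.
  - by move=> M /gen_group_mball.
  - by move=> k l M; apply: mball_mono.
exists k0 => k w le_k0 wk; have Hw : gen_group S w.
  by apply/gen_group_mball; exists k.+1.
have [v vk vwZ] := k0P _ Hw; exists v, (invmx v *m w).
have {}vk := mball_mono le_k0 vk; have [uv Vv] := mball_inv Gunit GV vk.
split=> //; last by rewrite mulKVmx.
by apply/(mem_mglz _ _ Gunit GV); split=> //; apply: mball_mul.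
Qed.

End Groups.

(** * Correctness of the search *)

Section Correctness.
Variables (n : nat) (S : seq 'M[rat]_n).
Hypothesis Sunit : forall s, s \in S -> s \in unitmx.
Implicit Types (M : 'M[rat]_n) (K : nat).

Let G := with_inverses S.
Let raw := map (@list_of n) S.

Lemma mx_of_raw : map (mx_of n) raw = S.
Proof. by rewrite -map_comp map_id_in // => s _; apply: list_ofK. Qed.

Lemma invertible_genP K :
  reflect (forall s, s \in S -> invmx s \in map (mx_of n) (cand n K))
    (all (fun s => has (fun t => leqm n (lmul n s t) (lone n)) (cand n K)) raw).
Proof.
rewrite all_map; apply: (iffP allP) => inv s Ss.
  have /hasP[t ct] := inv s Ss; rewrite leqmE mx_of_lmul mx_of_lone list_ofK.
  by move=> /eqP st; rewrite (invmx_uniq st) map_f.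
have /mapP[t ct def_t] := inv s Ss; apply/hasP; exists t => //.
by rewrite leqmE mx_of_lmul mx_of_lone list_ofK -def_t mulmxV ?Sunit.
Qed.

Lemma gens_mem K :
  (forall s, s \in S -> invmx s \in map (mx_of n) (cand n K)) ->
  map (mx_of n) (gens n K raw) =i G.
Proof.
move=> inv M; rewrite map_cat mx_of_raw !mem_cat; congr orb.
apply/mapP/mapP => [[t]|[s Ss ->]].
  rewrite mem_filter => /andP[/hasP[_ /mapP[s Ss ->] st] _ ->].
  move: st; rewrite leqmE mx_of_lmul mx_of_lone list_ofK => /eqP st.
  by exists s; rewrite ?(invmx_uniq st).
have /mapP[t ct def_t] := inv s Ss; exists t => //.
rewrite mem_filter ct andbT; apply/hasP; exists (list_of s); first exact: map_f.
by rewrite leqmE mx_of_lmul mx_of_lone list_ofK -def_t mulmxV ?Sunit.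
Qed.

Lemma mem_conjugators K (L : seq mat) (a b : mat) :
  ((a, b) \in conjugators n K L) =
    [&& a \in cand n K, b \in cand n K, mx_of n a *m mx_of n b == 1%:M &
        all (fun s => intmx (mx_of n b *m (s *m mx_of n a))) (map (mx_of n) L)].
Proof.
rewrite mem_filter /= leqmE mx_of_lmul mx_of_lone all_map andbC.
have -> : ((a, b) \in [seq (g, g') | g <- cand n K, g' <- cand n K]) =
    (a \in cand n K) && (b \in cand n K).
  by apply/allpairsP/andP => [[[c d] [cc cd [-> ->]]]|[ca cb]]; last exists (a, b).
rewrite -andbA; congr [&& _, _, _ & _]; apply: eq_all => s /=.
by rewrite lintE !mx_of_lmul.
Qed.

Lemma mx_of_int_gens K :
  map (mx_of n) (gens n K raw) =i G ->
  map (mx_of n) (int_gens n K raw) =i mglz (mball G (K + K.+1)).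
Proof.
by move=> eqG; rewrite mx_of_glz mx_of_ball; apply/eq_mglz/eq_mball.
Qed.

Lemma check_sound K : check n K raw ->
  let g := mx_of n (head ([::], [::]) (conjugators n K (gens n K raw))).1 in
  let T := map (mx_of n) (int_gens n K raw) in
  [/\ g \in unitmx,
      forall h, gen_group S h -> in_GLZ (invmx g *m h *m g)
    & forall h, gen_group T h <-> int_part (gen_group S) h].
Proof.
case/and3P=> /invertible_genP/gens_mem eqG /allP step conj g T.
(* The third condition of [check] makes the list nonempty, so [head] does not return its default. *)
have : head ([::], [::]) (conjugators n K (gens n K raw)) \in
    conjugators n K (gens n K raw) by rewrite -nth0 mem_nth.
rewrite {}/g; case: (head _ _) => a b /=.
rewrite mem_conjugators => /and4P[_ _ /eqP ab /allP intab].
have [ua _] := mulmx1_unit ab; split=> //.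
  apply: conj_in_GLZ => // s Gs; rewrite (invmx_uniq ab).
  by apply: intab; rewrite eqG.
apply: (int_part_generated Sunit (k := K)); first exact: mx_of_int_gens.
move=> w; rewrite -(eq_mball _ eqG) -mx_of_ball => /mapP[x xB ->].
have /hasP[v vB /hasP[t tT]] := step _ xB.
rewrite leqmE mx_of_lmul => /eqP ->; exists (mx_of n v), (mx_of n t).
by split; rewrite ?map_f // -(eq_mball _ eqG) -mx_of_ball map_f.
Qed.

Lemma cand_eventually M :
  exists K0, forall K, (K0 <= K)%N -> M \in map (mx_of n) (cand n K).
Proof.
have [K0 K0P] := cand_mem M; exists K0 => K /K0P cM.
by apply/mapP; exists (list_of M); rewrite ?list_ofK.
Qed.

(** Each condition of [check] holds from some bound on, so all hold together at a large bound. *)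
Lemma check_complete d :
  common_denominator (gen_group S) d -> exists K, check n K raw.
Proof.
move=> Hd; have [k0 reduce] := words_reduce Sunit Hd.
have [g ug intg] := integral_conjugator (gen_group_1 S) (@gen_group_mul n S) Hd.
have [Kg KgP] := cand_eventually g; have [Kg' Kg'P] := cand_eventually (invmx g).
have [Ki KiP] : exists K0, forall K, (K0 <= K)%N ->
    forall s, s \in S -> invmx s \in map (mx_of n) (cand n K).
  elim: {reduce intg Hd} S => [|s S' [K1 K1P]]; first by exists 0%N.
  have [K2 K2P] := cand_eventually (invmx s); exists (maxn K1 K2) => K.
  rewrite geq_max => /andP[/K1P inS' /K2P ins] t; rewrite inE => /predU1P[->//|].
  exact: inS'.
(* The sum dominates the bounds for word reduction, for [g], for its inverse and for the inverses of
   the generators. *)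
pose K := (k0 + (Kg + (Kg' + Ki)))%N; exists K.
have le_k0 : (k0 <= K)%N by rewrite /K; lia.
have inv := KiP K ltac:(rewrite /K; lia); have eqG := gens_mem inv.
apply/and3P; split; first exact/invertible_genP.
  apply/allP => x xB; have : mx_of n x \in mball G K.+1.
    by rewrite -(eq_mball _ eqG) -mx_of_ball map_f.
  move=> /(reduce _ _ le_k0)[v [t []]].
  rewrite -(eq_mball _ eqG) -mx_of_ball => /mapP[y yB ->].
  rewrite -(mx_of_int_gens eqG) => /mapP[z zT ->] def_x.
  apply/hasP; exists y => //; apply/hasP; exists z => //.
  by rewrite leqmE mx_of_lmul def_x.
have /mapP[a ca def_a] := KgP K ltac:(rewrite /K; lia).
have /mapP[b cb def_b] := Kg'P K ltac:(rewrite /K; lia).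
suff : (a, b) \in conjugators n K (gens n K raw) by case: (conjugators _ _ _).
rewrite mem_conjugators ca cb -def_a -def_b mulmxV // eqxx; apply/allP => s.
rewrite eqG mulmxA => Gs; apply: intg; apply/gen_group_mball => //.
by exists 1%N; apply: mball_gen.
Qed.

End Correctness.

Theorem mainTheorem4 :
  exists p : prog,
    forall (n : nat) (S : seq 'M[rat]_n) (d : nat),
      (forall A : 'M[rat]_n, A \in S -> A \in unitmx) ->
      common_denominator (gen_group S) d ->
      exists (g : 'M[rat]_n) (T : seq 'M[rat]_n),
        [/\ exec p (enc_input S d) (enc_output g T),
            g \in unitmx,
            forall h : 'M[rat]_n,
              gen_group S h -> in_GLZ (invmx g *m h *m g)
          & forall h : 'M[rat]_n,
              gen_group T h <-> int_part (gen_group S) h].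
Proof.
have [p pP] := exec_answer; exists p => n S d Sunit Hd.
have [K checkK execK] := pP n (map (@list_of n) S) d (check_complete Sunit Hd).
have [ug conj_g genT] := check_sound Sunit checkK.
exists (mx_of n (head ([::], [::]) (conjugators n K (gens n K (map (@list_of n) S)))).1).
exists (map (mx_of n) (int_gens n K (map (@list_of n) S))); split=> //.
(* The encodings of matrices in the statement are those of their lists of rows, which the program
   handles. *)
rewrite /enc_output -enc_canon -enc_canon_seq /enc_input -enc_list_of_seq.
exact: execK.
Qed.
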